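(* Let $S$ be a subsemigroup of $T(X)$ with $Inj(X)\subset S$. Then $S$ is a maximal subsemigroup of $T(X)$ if and only if $S=T(X)\setminus H$ for some $H\in\{Sur(X),C_p(X),IF(X)\}$.
   Context: $X$ is a countably infinite set (one may take $X=\mathbb{N}$) and $T(X)$ is the monoid of all full transformations (maps $X\to X$) under composition. A subsemigroup $S$ of $T(X)$ is maximal if $S\neq T(X)$ and there is no subsemigroup of $T(X)$ lying strictly between $S$ and $T(X)$. For $\alpha\in T(X)$: $im\,\alpha$ is its range, $rank(\alpha)=|im\,\alpha|$, the defect is $d(\alpha)=|X\setminus im\,\alpha|$, the collapse is $c(\alpha)=\sum_{y\in im\,\alpha}(|y\alpha^{-1}|-1)$, where $y\alpha^{-1}$ is the preimage of $y$, and the infinite contractive index is $k(\alpha)=|\{x\in im\,\alpha\mid |x\alpha^{-1}|=\aleph_0\}|$. $Inj(X)=\{\alpha\in T(X)\mid rank(\alpha)=\aleph_0,\ c(\alpha)=0,\ d(\alpha)\neq 0\}$ (injective but not surjective maps); $Sur(X)=\{\alpha\in T(X)\mid rank(\alpha)=\aleph_0,\ c(\alpha)\neq 0,\ d(\alpha)=0\}$ (surjective but not injective maps); $C_p(X)=\{\alpha\in T(X)\mid rank(\alpha)=\aleph_0,\ k(\alpha)=\aleph_0\}$; $IF(X)=\{\alpha\in T(X)\mid rank(\alpha)=\aleph_0,\ c(\alpha)=\aleph_0,\ d(\alpha)<\aleph_0\}$. *)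

(* Defs.v *)
From mathcomp Require Import all_boot all_order all_algebra.
From mathcomp Require Import all_classical all_reals.
From mathcomp Require Import ereal esum measure.
From mathcomp Require Import Rstruct.
From Stdlib Require Rdefinitions.

Set Implicit Arguments.
Unset Strict Implicit.
Unset Printing Implicit Defensive.
Import Order.TTheory GRing.Theory Num.Theory.

Local Open Scope classical_set_scope.
Local Open Scope ring_scope.
Local Open Scope ereal_scope.

Notation transf X := (X -> X).

(* Cardinals at most aleph_0 are represented by their values in
   {0, 1, 2, ..., +oo}, inside the extended reals: only subsets of a countable
   set are measured, so +oo stands for aleph_0.  The carrier R serves only to
   give access to infinite sums. *)
Definition ecard (T : choiceType) (A : set T) : \bar Rdefinitions.R := counting A.

Section Indices.
Variable X : choiceType.
Implicit Types f : transf X.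

Definition rank f := ecard (range f).

Definition defect f := ecard (~` range f).

(* For an infinite kernel class, +oo - 1 = +oo, as in cardinal arithmetic. *)
Definition collapse f : \bar Rdefinitions.R :=
  \esum_(y in range f) (ecard (f @^-1` [set y]) - 1).

Definition contractive_index f :=
  ecard [set y | range f y /\ ecard (f @^-1` [set y]) = +oo].

End Indices.

Section Families.
Variable X : choiceType.

Definition inj_maps : set (transf X) :=
  [set f | [/\ rank f = +oo, collapse f = 0 & defect f <> 0]].

Definition sur_maps : set (transf X) :=
  [set f | [/\ rank f = +oo, collapse f <> 0 & defect f = 0]].

Definition cp_maps : set (transf X) :=
  [set f | rank f = +oo /\ contractive_index f = +oo].

Definition if_maps : set (transf X) :=
  [set f | [/\ rank f = +oo, collapse f = +oo & defect f < +oo]].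

End Families.
Arguments inj_maps X : clear implicits.
Arguments sur_maps X : clear implicits.
Arguments cp_maps X : clear implicits.
Arguments if_maps X : clear implicits.

Section Subsemigroups.
Variable X : Type.
Implicit Types S M : set (transf X).

Definition subsemigroup S :=
  S !=set0 /\ forall a b, S a -> S b -> S (a \; b).

Definition maximal_subsemigroup S :=
  [/\ subsemigroup S, S <> setT &
      ~ exists M, [/\ subsemigroup M, S `<` M & M `<` setT]].

End Subsemigroups.

(* Main.v *)
(* Maps are composed from left to right.  The key point is that Inj(X) together
   with one map f in Sur(X), one map p in C_p(X) and one map q in IF(X)
   generates T(X).  Sections of f are non-surjective injections, so f yields
   every permutation; permutations and f yield, for every finite set Z, a map
   sending the complement of Z onto X.  Following q by such a map for
   Z = X \ im q gives a surjection h with infinite collapse, so h has a section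
   t with infinite co-image.  Given any g, embed X by e into the set of points
   with infinite p-fibre, lift g; e through p to a non-surjective injection a,
   and extend e x |-> t x to a non-surjective injection i: then g = a; p; i; h.
   As the complement of each of the three families is a subsemigroup
   containing Inj(X), and as each family has a member outside the two others,
   these complements are exactly the maximal subsemigroups above Inj(X). *)

Require Import Defs.
From mathcomp Require Import all_boot all_order all_algebra.
From mathcomp Require Import all_classical.
From mathcomp Require Import ereal esum measure Rstruct finmap.

Set Implicit Arguments.
Unset Strict Implicit.
Unset Printing Implicit Defensive.
Import Order.TTheory GRing.Theory Num.Theory.

Local Open Scope classical_set_scope.

(** * Embeddings and sections on a countable set *)

Lemma infinite_setT_countable (X : Type) :
  ([set: X] #= [set: nat])%card -> infinite_set [set: X].
Proof. by move=> /card_eqPle[_ hX]; apply/infiniteP. Qed.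

(** A point [z] of [A] is set aside first, so that [j] misses a point of [A]; this keeps the
    injections built from [j] non-surjective. *)
Lemma infinite_embed (X : Type) (A : set X) :
  ([set: X] #= [set: nat])%card -> infinite_set A ->
  exists j : X -> X,
    [/\ injective j, forall x, A (j x) & exists2 z, A z & forall x, j x <> z].
Proof.
move=> /card_eqPle[hX _] infA; have [z Az] := infinite_setN0 infA.
have /infiniteP/(card_le_trans hX)/card_leP[f] : infinite_set (A `\ z).
  exact: infinite_setD.
pose sub x : set_type [set: X] := SigSub (mem_set (I : [set: X] x)).
exists (fun x => val (f (sub x))); split.
- move=> x y /val_inj/(inj (f := f)) e.
  by have /(congr1 val) := e (mem_set I) (mem_set I).
- by move=> x; have /set_mem[] := valP (f (sub x)).
- by exists z => // x; have /set_mem[] := valP (f (sub x)).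
Qed.

(** [s] picks one point in each nonempty fibre; it is a right inverse of [f] exactly when [f] is
    onto. *)
Lemma image_section (X : Type) (f : X -> X) :
  exists s : X -> X, forall x, f (s (f x)) = f x.
Proof.
have /choice[s sP] y : exists x, range f y -> f x = y.
  by have [[x _ <-]|ny] := pselect (range f y); [exists x | exists y => /ny].
by exists s => x; apply: sP; exists x.
Qed.

(** * Cardinals as infinite sums *)

Section Cardinals.
Local Open Scope ring_scope.
Local Open Scope ereal_scope.

Lemma esum_one (T : choiceType) (A : set T) : \esum_(i in A) 1 = ecard A.
Proof.
rewrite /ecard /counting; case: asboolP => [finA|infA].
  rewrite esum_fset// fsbig_finite//= sumEFin; congr (_%:E).
  by rewrite big_const_seq count_predT iter_addr_0.
apply/eqyP => r r0; apply: esum_ge.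
have [F FA Fr] := infinite_set_fset (Num.truncn r).+1 infA.
exists [set` F]; first by split.
rewrite fsbig_finite//= set_fsetK sumEFin lee_fin.
rewrite big_const_seq count_predT iter_addr_0.
by apply: le_trans (ltW (truncnS_gt r)) _; rewrite ler_nat.
Qed.

(** Holds for infinite [A] too: only the finite summand 1 is cancelled. *)
Lemma ecardD1 (T : choiceType) (A : set T) x :
  A x -> ecard A - 1 = ecard (A `\ x).
Proof.
move=> Ax; rewrite -!esum_one (esumID [set x])//.
have -> : A `&` [set x] = [set x] by apply/seteqP; split=> [y []|y ->].
by rewrite esum_set1// -setDE addeC addeK.
Qed.

Lemma ecard_infinite (T : choiceType) (A : set T) :
  ecard A = +oo <-> infinite_set A.
Proof. by rewrite /ecard /counting; case: asboolP => // ?; split. Qed.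

Lemma ecard_finite (T : choiceType) (A : set T) :
  ecard A < +oo <-> finite_set A.
Proof.
rewrite /ecard /counting; case: asboolP => ?; last by rewrite ltxx; split.
by rewrite ltry; split.
Qed.

Lemma ecard0 (T : choiceType) (A : set T) : ecard A = 0 <-> A = set0.
Proof.
split=> [|->]; last by rewrite -esum_one esum_set0.
rewrite /ecard /counting; case: asboolP => // finA [] /eqP.
by rewrite pnatr_eq0 cardfs_eq0 => /eqP/(fset_set_set0 finA).
Qed.

(** Each fibre contributes its points other than the chosen one [s y]; the pairs (y, x) so obtained
    project bijectively to [x], since [y = f x]. *)
Lemma collapse_section (X : choiceType) (f s : transf X) :
  (forall x, f (s (f x)) = f x) ->
  collapse f = ecard [set x | s (f x) <> x].
Proof.
move=> fs; pose J y := (f @^-1` [set y]) `\ s y.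
transitivity (\esum_(y in range f) \esum_(x in J y) (1 : \bar Rdefinitions.R)).
  by apply: eq_esum => _ [x _ <-]; rewrite esum_one (ecardD1 (x := s (f x))).
rewrite esum_esum// -esum_one; apply/esym.
rewrite (@reindex_esum _ _ _ (range f `*`` J) _ snd) //; split.
- by move=> [y x] /= [_ [/= -> ]] /nesym.
- by move=> [y x] [y' x'] /set_mem[_ [/= <- _]] /set_mem[_ [/= <- _]] /= ->.
- move=> x /= nx; exists (f x, x) => //; split=> /=; first by exists x.
  by split=> //; exact/nesym.
Qed.
End Cardinals.

(** * The indices and the families without cardinals *)

(** This amounts to finite collapse, in a form that passes easily through composition. *)
Definition almost_injective (X : Type) (f : X -> X) :=
  exists2 F, finite_set F & set_inj (~` F) f.

Lemma finite_setI_preimage (T U : Type) (A : set T) (B : set U) (f : T -> U) :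
  set_inj A f -> finite_set B -> finite_set (A `&` f @^-1` B).
Proof.
move=> injf finB.
have injAB : set_inj (A `&` f @^-1` B) f.
  by move=> x y /set_mem[Ax _] /set_mem[Ay _]; apply: injf; exact/mem_set.
rewrite -(eq_finite_set (inj_card_eq injAB)).
by apply: sub_finite_set finB => _ [x [_ Bfx] <-].
Qed.

Lemma almost_injective_finite_preimage (X : Type) (f : X -> X) (B : set X) :
  almost_injective f -> finite_set B -> finite_set (f @^-1` B).
Proof.
move=> [F finF injf] finB.
apply: (@sub_finite_set _ _ (F `|` (~` F `&` f @^-1` B))); last first.
  by rewrite finite_setU; split=> //; exact: finite_setI_preimage.
by move=> x Bfx; have [|] := pselect (F x); [left | right].
Qed.

Lemma collapse_eq0 (X : choiceType) (f : transf X) :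
  collapse f = 0%E <-> injective f.
Proof.
have [s fs] := image_section f; rewrite (collapse_section fs) ecard0; split.
  move=> D0; have sf x : s (f x) = x.
    by apply: contrapT => nx; have : [set x | s (f x) <> x] x by []; rewrite D0.
  exact: can_inj sf.
by move=> injf; rewrite -subset0 => x; apply; apply: injf.
Qed.

(** If [f] is injective off [F], then so is [s \o f], and it sends into [F] every [x] outside [F]
    that it moves; hence it moves finitely many points. *)
Lemma collapse_eqy (X : choiceType) (f : transf X) :
  collapse f = +oo%E <-> ~ almost_injective f.
Proof.
have [s fs] := image_section f; rewrite (collapse_section fs) ecard_infinite.
split=> [infD [F finF injf]|ninjf finD]; last first.
  apply: ninjf; exists [set x | s (f x) <> x] => //.
  move=> x y /set_mem /= /contrapT sx /set_mem /= /contrapT sy e.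
  by rewrite -sx e sy.
apply: infD; apply: (@sub_finite_set _ _ (F `|` (~` F `&` (s \o f) @^-1` F))).
  move=> x /= nx; have [|Fx] := pselect (F x); [by left | right; split=> //=].
  apply: contrapT => Fsfx; apply: nx.
  by apply: injf; rewrite ?fs//; exact/mem_set.
rewrite finite_setU; split=> //; apply: finite_setI_preimage => // x y Fx Fy.
by move=> /(congr1 f) /=; rewrite !fs; exact: injf.
Qed.

Lemma injective_infinite_range (T U : Type) (f : T -> U) :
  infinite_set [set: T] -> injective f -> infinite_set (range f).
Proof.
move=> infT injf.
have injfT : set_inj [set: T] f by move=> x y _ _; exact: injf.
by rewrite (eq_finite_set (inj_card_eq injfT)).
Qed.

Lemma rangeTE (T U : Type) (f : T -> U) :
  range f = setT <-> forall y, exists x, f x = y.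
Proof.
split=> [fT y|fT].
  by have [x _ <-] : range f y by [rewrite fT]; exists x.
by rewrite -subTset => y _; have [x <-] := fT y; exists x.
Qed.

Lemma not_surjectiveP (T U : Type) (f : T -> U) :
  range f <> setT <-> exists z, forall x, f x <> z.
Proof.
rewrite rangeTE -existsNP; split=> -[z zP]; exists z.
  by move=> x fxz; apply: zP; exists x.
by move=> [x]; exact: zP.
Qed.

Lemma defect_eq0 (X : choiceType) (f : transf X) :
  defect f = 0%E <-> range f = setT.
Proof.
rewrite /defect ecard0; split=> [/(congr1 (@setC _))|->]; last exact: setCT.
by rewrite setCK setC0. Qed.

Lemma inj_mapsE (X : choiceType) (f : transf X) : infinite_set [set: X] ->
  inj_maps X f <-> injective f /\ exists z, forall x, f x <> z.
Proof.
move=> infX; split=> [[_ /collapse_eq0 injf df]|[injf /not_surjectiveP df]].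
  by split=> //; apply/not_surjectiveP; rewrite -defect_eq0.
split; last by rewrite defect_eq0.
  exact/ecard_infinite/injective_infinite_range.
exact/collapse_eq0.
Qed.

Lemma sur_mapsE (X : choiceType) (f : transf X) : infinite_set [set: X] ->
  sur_maps X f <-> (forall y, exists x, f x = y) /\ ~ injective f.
Proof.
move=> infX; rewrite -rangeTE -defect_eq0 -collapse_eq0.
split=> [[]//|[df cf]]; split=> //; apply/ecard_infinite.
by move/defect_eq0: df => ->.
Qed.

Lemma cp_mapsE (X : choiceType) (f : transf X) :
  cp_maps X f <-> infinite_set [set y | infinite_set (f @^-1` [set y])].
Proof.
rewrite /cp_maps /= /rank /contractive_index !ecard_infinite.
have -> : [set y | range f y /\ ecard (f @^-1` [set y]) = +oo%E]
    = [set y | infinite_set (f @^-1` [set y])].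
  apply/seteqP; split=> y /=; first by move=> [_ /ecard_infinite].
  move=> fy; split; last exact/ecard_infinite.
  by have [x <-] := infinite_setN0 fy; exists x.
split=> [[]//|k]; split=> //; apply: sub_infinite_set k => y /infinite_setN0.
by move=> [x <-]; exists x.
Qed.

Lemma if_mapsE (X : choiceType) (f : transf X) : infinite_set [set: X] ->
  if_maps X f <-> finite_set (~` range f) /\ ~ almost_injective f.
Proof.
move=> infX; rewrite -collapse_eqy -ecard_finite.
split=> [[]//|[df cf]]; split=> //; apply/ecard_infinite.
by apply: cofinite_set_infinite => //; exact/ecard_finite.
Qed.

(** * Closure of the three complements under composition *)

(** If the product is in Sur(X), then [b] is onto, hence bijective, and cancelling it puts [a] in
    Sur(X). *)
Lemma subsemigroup_setC_sur (X : choiceType) (a b : transf X) :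
  infinite_set [set: X] ->
  ~ sur_maps X a -> ~ sur_maps X b -> ~ sur_maps X (a \; b).
Proof.
move=> infX; rewrite !sur_mapsE// => na nb [sab nab].
have sb y : exists x, b x = y by have [x <-] := sab y; exists (a x).
have injb : injective b by apply: contrapT => ?; apply: nb.
apply: na; split=> [y|inja]; last by apply: nab => x y /injb/inja.
by have [x /injb] := sab (b y); exists x.
Qed.

(** An infinite fibre of the product over [y] either has an infinite [b]-fibre below it or is a
    finite union of [a]-fibres, one of them infinite. *)
Lemma subsemigroup_setC_cp (X : choiceType) (a b : transf X) :
  ~ cp_maps X a -> ~ cp_maps X b -> ~ cp_maps X (a \; b).
Proof.
rewrite !cp_mapsE; set A := [set y | _] => /contrapT finA.
set B := [set y | _] => /contrapT finB; apply.
apply: (@sub_finite_set _ _ (B `|` b @` A)); last first.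
  by rewrite finite_setU; split=> //; exact: finite_image.
move=> y /= aby.
have [/= finby|] := pselect (finite_set (b @^-1` [set y])); last by left.
right; apply: contrapT => nA; apply: aby.
have -> : (a \; b) @^-1` [set y]
    = \bigcup_(z in b @^-1` [set y]) a @^-1` [set z].
  by apply/seteqP; split=> [x /= <-|x [z /= <- <-]//]; exists (a x).
apply: bigcup_finite => // z bz; apply: contrapT => az.
by apply: nA; exists z.
Qed.

(** If the product is in IF(X), then [b] has finite defect, so it is almost injective; this gives
    [a] finite defect, so [a] is almost injective, and then so is the product. *)
Lemma subsemigroup_setC_if (X : choiceType) (a b : transf X) :
  infinite_set [set: X] ->
  ~ if_maps X a -> ~ if_maps X b -> ~ if_maps X (a \; b).
Proof.
move=> infX; rewrite !if_mapsE// => na nb [dab nab].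
have /contrapT ib : ~ ~ almost_injective b.
  move=> ib; apply: nb; split=> //; apply: sub_finite_set dab.
  by apply: subsetC => _ [x _ <-]; exists (a x).
have [F finF injb] := ib.
have /contrapT[G finG inja] : ~ ~ almost_injective a.
  move=> ia; apply: na; split=> //.
  (* For [x] missed by [a] and outside [F], if [b x = b (a z)] then [a z] lies in [F], for otherwise
     [x = a z]. *)
  apply: (@sub_finite_set _ _
      (F `|` b @^-1` (~` range (a \; b) `|` b @` F))); last first.
    rewrite finite_setU; split=> //.
    apply: almost_injective_finite_preimage => //.
    by rewrite finite_setU; split=> //; exact: finite_image.
  move=> x nax; have [|Fx] := pselect (F x); [by left | right].
  have [[z _ /= bz]|] := pselect (range (a \; b) (b x)); [right | by left].
  exists (a z) => //; apply: contrapT => Faz; apply: nax; exists z => //.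
  by apply: injb => //; exact/mem_set.
apply: nab; exists (G `|` (~` G `&` a @^-1` F)).
  by rewrite finite_setU; split=> //; exact: finite_setI_preimage.
have off x : (~` (G `|` (~` G `&` a @^-1` F))) x -> ~ G x /\ ~ F (a x).
  move=> nx; split=> h; apply: nx; first by left.
  by have [|Gx] := pselect (G x); [left | right].
move=> x y /set_mem/off[Gx Fx] /set_mem/off[Gy Fy] eab.
by apply: inja; [exact/mem_set..|apply: injb => //; exact/mem_set].
Qed.

(** * Lifting and extending injections *)

(** [J y] embeds all of [X] into the fibre over [y]. The diagonal [J (u x) x] is injective, as [p]
    recovers [u x] and hence the embedding used. *)
Lemma lift_through_infinite_fibers (X : Type) (p u : X -> X) :
  ([set: X] #= [set: nat])%card ->
  (forall x, infinite_set (p @^-1` [set u x])) ->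
  exists a : X -> X,
    [/\ injective a, exists z, forall x, a x <> z & forall x, p (a x) = u x].
Proof.
move=> hX pu.
have /choice[J JP] y : exists j : X -> X, infinite_set (p @^-1` [set y]) ->
    [/\ injective j, forall x, p (j x) = y &
        exists2 z, p z = y & forall x, j x <> z].
  have [|fin] := pselect (infinite_set (p @^-1` [set y])); last by exists id.
  by move=> /(infinite_embed hX)[j jP]; exists j.
have pJ x x' : p (J (u x) x') = u x by have [] := JP _ (pu x).
exists (fun x => J (u x) x); split=> //.
  move=> x y e; have euxy : u x = u y by rewrite -(pJ x x) e pJ.
  by have [injJ _ _] := JP _ (pu x); apply: injJ; rewrite e euxy.
have [x0 _] := infinite_setN0 (infinite_setT_countable hX).
have [_ _ [z pz nz]] := JP _ (pu x0); exists z => x e.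
by apply: (nz x); rewrite -e -pz -e pJ.
Qed.

(** Off the range of [e], [i] follows an embedding into the complement of the range of [t] that
    leaves one point free. *)
Lemma extend_injection (X : Type) (e t : X -> X) :
  ([set: X] #= [set: nat])%card ->
  injective e -> injective t -> infinite_set (~` range t) ->
  exists i : X -> X,
    [/\ injective i, exists z, forall x, i x <> z & forall x, i (e x) = t x].
Proof.
move=> hX inje injt /(infinite_embed hX)[j [injj jt [z tz jz]]].
have [s es] := image_section e; have se x : s (e x) = x by exact/inje/es.
pose i x := if `[< range e x >] then t (s x) else j x.
have ie x : i (e x) = t x.
  by rewrite /i asboolT ?se//; exists x.
have ij x : ~ range e x -> i x = j x by move=> nx; rewrite /i asboolF.
exists i; split=> //.
  have tj x y : t x <> j y by move=> txy; apply: (jt y); exists x.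
  move=> x y; have [[x' _ <-]|nx] := pselect (range e x);
    have [[y' _ <-]|ny] := pselect (range e y); rewrite ?ie ?ij//.
  - by move/injt => ->.
  - by move/tj.
  - by move/esym/tj.
  - by move/injj.
exists z => x; have [[x' _ <-]|nx] := pselect (range e x).
  by rewrite ie => tx; apply: tz; exists x'.
by rewrite ij.
Qed.

(** * Generating T(X) from Inj(X) and one map of each family *)

Section Generation.
Variables (X : choiceType) (S : set (transf X)).
Hypothesis hX : ([set: X] #= [set: nat])%card.
Hypothesis closed_S : forall a b, S a -> S b -> S (a \; b).
Hypothesis injS : inj_maps X `<=` S.

Let infX := infinite_setT_countable hX.

Let injS' a : injective a -> (exists z, forall x, a x <> z) -> S a.
Proof. by move=> ia na; apply: injS; apply/inj_mapsE. Qed.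

Lemma bijective_mem f (pi pi' : transf X) : sur_maps X f -> S f ->
  cancel pi pi' -> cancel pi' pi -> S pi.
Proof.
move=> /(sur_mapsE _ infX)[sf nf] Sf piK piK'; have [s fs'] := image_section f.
have fs y : f (s y) = y by have [x <-] := sf y.
have -> : pi = (pi \; s) \; f by apply/funext => x /=; rewrite fs.
apply: closed_S => //; apply: injS'.
  exact: inj_comp (can_inj fs) (can_inj piK).
(* Were [pi \; s] onto, so would be [s], which would then invert [f] on both sides. *)
apply: contrapT => surjs; apply: nf => x y exy.
have sK z : s (f z) = z.
  have [w <-] : exists w, s (pi w) = z; last by rewrite fs.
  by apply: contrapT => nz; apply: surjs; exists z => w e; apply: nz; exists w.
by rewrite -(sK x) exy sK.
Qed.

Lemma surjective_off_seq f (r : seq X) : sur_maps X f -> S f ->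
  exists2 h, S h & forall y, exists2 x, x \notin r & h x = y.
Proof.
move=> fSur Sf; have [sf nf] := (sur_mapsE f infX).1 fSur.
have [x [y [xy fxy]]] : exists x y, x <> y /\ f x = f y.
  apply: contrapT => nxy; apply: nf => x y fxy; apply: contrapT => ?.
  by apply: nxy; exists x, y.
(* Induction on the length, since the hypothesis is applied to a list of images of [r]. *)
have [n] := ubnP (size r); elim: n r => // n IH [_|z r].
  by exists f => // w; have [v <-] := sf w; exists v.
rewrite ltnS => rn.
pose sw u := if u == z then x else if u == x then z else u.
have swK : involutive sw.
  move=> u; rewrite /sw; have [->|uz] := eqVneq u z.
    by have [->|_] := eqVneq x z; rewrite ?eqxx.
  have [->|ux] := eqVneq u x; first by rewrite eqxx.
  by rewrite (negbTE uz) (negbTE ux).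
have Ssw : S sw by exact: (bijective_mem fSur Sf swK swK).
(* The transposition of z and x makes z redundant for the values of sw; f, so
   only the images of the remaining points have to be avoided afterwards. *)
have [h' Sh' h'P] := IH [seq f (sw u) | u <- r] ltac:(by rewrite size_map).
exists ((sw \; f) \; h'); first by apply: closed_S => //; exact: closed_S.
move=> w; have [v vr <-] := h'P w.
(* As [sw z = x], the point [z] is needed only when [x] is the chosen preimage of [v]; then its twin
   [y] replaces [x]. *)
have [u [uz fu]] : exists u, u != z /\ f (sw u) = v.
  have [u fu] := sf v; have [ux|ux] := eqVneq u x.
    exists (sw y); rewrite swK -fxy -ux; split=> //.
    by rewrite -(inj_eq (can_inj swK)) swK {1}/sw eqxx; apply/eqP/nesym.
  exists (sw u); rewrite swK; split=> //.
  by rewrite -(inj_eq (can_inj swK)) swK {1}/sw eqxx.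
exists u; last by rewrite /= fu.
rewrite inE negb_or uz /=; apply: contra vr => ur.
by rewrite -fu; apply: map_f.
Qed.

Lemma surjective_not_almost_injective f q :
  sur_maps X f -> S f -> if_maps X q -> S q ->
  exists h, [/\ S h, forall y, exists x, h x = y & ~ almost_injective h].
Proof.
move=> fSur Sf /(if_mapsE _ infX)[/finite_seqP[r dq] nq] Sq.
have [h Sh hP] := surjective_off_seq r fSur Sf.
exists (q \; h); split.
- exact: closed_S.
- move=> y; have [x xr <-] := hP y.
  have [[z _ <-]|nx] := pselect (range q x); first by exists z.
  by have /= : [set` r] x by [rewrite -dq]; rewrite (negbTE xr).
- move=> [F finF inj]; apply: nq; exists F => // x y Fx Fy e.
  by apply: inj => //=; rewrite e.
Qed.

Lemma generates_setT f p q : sur_maps X f -> S f -> cp_maps X p -> S p ->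
  if_maps X q -> S q -> S = setT.
Proof.
move=> fSur Sf /cp_mapsE pCp Sp qIF Sq.
have [h [Sh surh nh]] := surjective_not_almost_injective fSur Sf qIF Sq.
have [t ht'] := image_section h.
have ht y : h (t y) = y by have [x <-] := surh y.
have inft : infinite_set (~` range t).
  (* [h] is injective on the range of its section [t]. *)
  move=> fint; apply: nh; exists (~` range t) => //; rewrite setCK.
  by move=> x y /set_mem[x' _ <-] /set_mem[y' _ <-]; rewrite !ht => ->.
have [e [inje pe _]] := infinite_embed hX pCp.
have [i [inji ni ie]] := extend_injection hX inje (can_inj ht) inft.
rewrite -subTset => g _.
have [a [inja na pa]] := lift_through_infinite_fibers hX (fun x => pe (g x)).
(* The successive images of [x] are [a x], [e (g x)], [t (g x)] and [g x]. *)
have -> : g = (a \; p) \; (i \; h).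
  by apply/funext => x /=; rewrite pa ie ht.
by apply: closed_S; apply: closed_S => //; exact: injS'.
Qed.

End Generation.

(** * Maps lying in exactly one of the families *)

Section Witnesses.
Variables (X : choiceType) (phi : X -> nat) (psi : nat -> X).
Hypotheses (phiK : cancel phi psi) (psiK : cancel psi phi).

Let infX : infinite_set [set: X].
Proof.
apply: sub_infinite_set (injective_infinite_range infinite_nat (can_inj psiK)).
by [].
Qed.

Lemma finite_below n : finite_set [set x | (phi x < n)%N].
Proof.
by apply: (@finite_preimage _ _ `I_n) => // x y _ _; exact: can_inj phiK _ _.
Qed.

Lemma not_cp_maps_bounded_fibers (u : nat -> nat) (b : nat -> nat) :
  (forall n, n < b (u n))%N -> ~ cp_maps X (psi \o u \o phi).
Proof.
move=> ub; rewrite cp_mapsE => /infinite_setN0[y]; apply.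
by apply: sub_finite_set (finite_below (b (phi y))) => x /= <-; rewrite psiK.
Qed.

(** The predecessor on the naturals identifies only 0 and 1. *)
Lemma sur_not_cp_if :
  exists f, [/\ sur_maps X f, ~ cp_maps X f & ~ if_maps X f].
Proof.
exists (psi \o predn \o phi); split.
- rewrite sur_mapsE//; split=> [y|injf].
    by exists (psi (phi y).+1); rewrite /= psiK /= phiK.
  have /(can_inj psiK) // : psi 0 = psi 1.
  by apply: injf; rewrite /= !psiK.
- by apply: (@not_cp_maps_bounded_fibers _ (fun n => n.+2)) => -[].
- rewrite if_mapsE// => -[_]; apply.
  exists [set psi 0]; first exact: finite_set1.
  move=> x y /set_mem /= x0 /set_mem /= y0 /(can_inj psiK) e.
  rewrite -(phiK x) -(phiK y) in x0 y0 *; move: e x0 y0.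
  by case: (phi x) (phi y) => [|m] [|n] //= ->.
Qed.

(** Twice the 2-adic valuation: the fibre over 2k contains all 2^k 3^j, and every odd number is
    missed. *)
Lemma cp_not_sur_if :
  exists f, [/\ cp_maps X f, ~ sur_maps X f & ~ if_maps X f].
Proof.
pose f := psi \o (fun n => (logn 2 n).*2) \o phi.
have nodd k x : f x <> psi k.*2.+1.
  by move=> /(can_inj psiK)/(congr1 odd) /=; rewrite !odd_double.
exists f; split.
- rewrite cp_mapsE; apply: sub_infinite_set
    (injective_infinite_range (f := fun k => psi k.*2) infinite_nat _).
    move=> _ [k _ <-] /=; apply: sub_infinite_set
      (injective_infinite_range (f := fun j => psi (2 ^ k * 3 ^ j)%N)
        infinite_nat _).
      move=> _ [j _ <-]; rewrite /f /= psiK lognM ?expn_gt0// !lognX.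
      by rewrite muln1 muln0 addn0.
    move=> i j /(can_inj psiK)/eqP; rewrite eqn_pmul2l ?expn_gt0//.
    by rewrite eqn_exp2l// => /eqP.
  by move=> i j /(can_inj psiK)/double_inj.
- by rewrite sur_mapsE// => -[/(_ (psi 1)) [x /(nodd 0)]].
- rewrite if_mapsE// => -[+ _]; apply: sub_infinite_set
    (injective_infinite_range (f := fun k => psi k.*2.+1) infinite_nat _).
    by move=> _ [k _ <-] [x _ /nodd].
  by move=> i j /(can_inj psiK)[/double_inj].
Qed.

(** Halving and adding 1 is two-to-one and misses only 0. *)
Lemma if_not_sur_cp :
  exists f, [/\ if_maps X f, ~ sur_maps X f & ~ cp_maps X f].
Proof.
exists (psi \o (fun n => n./2.+1) \o phi); split.
- rewrite if_mapsE//; split=> [|[F finF injF]].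
    apply: sub_finite_set (finite_set1 (psi 0)) => y /=.
    rewrite -(phiK y); case: (phi y) => [//|n] []; exists (psi n.*2) => //=.
    by rewrite psiK doubleK.
  (* F meets each pair {psi (2 k), psi (2 k + 1)} *)
  apply: infinite_nat.
  apply: sub_finite_set (finite_image (fun x => (phi x)./2) finF) => k _.
  have [F0|F0] := pselect (F (psi k.*2)).
    by exists (psi k.*2) => //; rewrite psiK doubleK.
  have [F1|F1] := pselect (F (psi k.*2.+1)).
    by exists (psi k.*2.+1) => //; rewrite psiK /= uphalf_double.
  have /(can_inj psiK)/(congr1 odd) : psi k.*2 = psi k.*2.+1.
    apply: injF; [exact/mem_set..|].
    by rewrite /= !psiK /= uphalf_double doubleK.
  by rewrite /= odd_double.
- rewrite sur_mapsE// => -[/(_ (psi 0)) [x /(can_inj psiK)]] //.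
- apply: (@not_cp_maps_bounded_fibers _ (fun n => n.*2)) => n.
  by rewrite doubleS -{1}(odd_double_half n); case: (odd n).
Qed.

End Witnesses.

(** * Maximal subsemigroups above Inj(X) *)

Lemma countable_bijection (X : Type) : ([set: X] #= [set: nat])%card ->
  exists (phi : X -> nat) (psi : nat -> X), cancel phi psi /\ cancel psi phi.
Proof.
move=> /card_set_bijP[phi]; rewrite setTT_bijective => -[psi phiK psiK].
by exists phi, psi.
Qed.

Theorem theorem9 (X : choiceType) (hX : ([set: X] #= [set: nat])%card)
    (S : set (transf X)) (hS : subsemigroup S) (hInj : inj_maps X `<=` S) :
  maximal_subsemigroup S <->
  exists H, [set sur_maps X; cp_maps X; if_maps X] H /\ S = setT `\` H.
Proof.
have infX := infinite_setT_countable hX.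
have [phi [psi [phiK psiK]]] := countable_bijection hX.
have [f [fS nfC nfI]] := sur_not_cp_if phiK psiK.
have [p [pc nps npi]] := cp_not_sur_if psiK.
have [q [qi nqs nqc]] := if_not_sur_cp phiK psiK.
have full M : (forall a b, M a -> M b -> M (a \; b)) -> inj_maps X `<=` M ->
    (forall H, [set sur_maps X; cp_maps X; if_maps X] H ->
       exists2 h, H h & M h) -> M = setT.
  move=> clM injM meets.
  have [|f' Hf Mf] := meets (sur_maps X); first by left; left.
  have [|p' Hp Mp] := meets (cp_maps X); first by left; right.
  have [|q' Hq Mq] := meets (if_maps X); first by right.
  exact: (generates_setT hX clM injM Hf Mf Hp Mp Hq Mq).
have proper H : [set sur_maps X; cp_maps X; if_maps X] H -> exists h, H h.
  by move=> [[]|] ->; [exists f | exists p | exists q].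
have clC H : [set sur_maps X; cp_maps X; if_maps X] H ->
    forall a b, (setT `\` H) a -> (setT `\` H) b -> (setT `\` H) (a \; b).
  move=> [[]|] -> a b [_ na] [_ nb]; split=> //.
  - exact: subsemigroup_setC_sur.
  - exact: subsemigroup_setC_cp.
  - exact: subsemigroup_setC_if.
split=> [[_ SnT Smax]|[H [HH SE]]].
  (* By [full], a proper [S] misses some family [H]; its complement is a proper subsemigroup, so
     maximality forces equality. *)
  have [H [HH SH]] : exists H,
      [set sur_maps X; cp_maps X; if_maps X] H /\ S `<=` setT `\` H.
    apply: contrapT => nH; apply: SnT; apply: full => //; first exact: hS.2.
    move=> H HH; apply: contrapT => nh; apply: nH; exists H; split=> // s Ss.
    by split=> // Hs; apply: nh; exists s.
  exists H; split=> //; apply/seteqP; split=> //; apply: contrapT => nHS.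
  apply: Smax; exists (setT `\` H); split.
  - split; last exact: clC.
    by have [s Ss] := hS.1; exists s; exact: SH.
  - by split.
  - by split=> // sub; have [h Hh] := proper H HH; have [] := sub h I.
split=> //.
  have [h Hh] := proper H HH => ST; have : S h by rewrite ST.
  by rewrite SE => -[].
move=> [M [[_ clM] [SM nMS] [_ nTM]]]; apply: nTM; rewrite (full M)//.
  exact: subset_trans hInj SM.
have [m [Mm Hm]] : exists m, M m /\ H m.
  apply: contrapT => nm; apply: nMS => x Mx; rewrite SE; split=> // Hx.
  by apply: nm; exists x.
have MC x : ~ H x -> M x by move=> Hx; apply: SM; rewrite SE.
(* [M] meets [H] in [m]; it meets any other family [K] in the witness of [K], which lies outside
   [H]. *)
move=> K HK; have [->|KH] := pselect (K = H); first by exists m.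
case: HH => [[]|] HE; case: HK => [[]|] KE; rewrite ?HE ?KE in KH MC *;
  do ?by case: KH.
- by exists p => //; apply: MC.
- by exists q => //; apply: MC.
- by exists f => //; apply: MC.
- by exists q => //; apply: MC.
- by exists f => //; apply: MC.
- by exists p => //; apply: MC.
Qed.
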